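(* Let $X=(\mathbb{R}^2,\sup)$ be the plane with the sup metric and basepoint the origin. The horofunction boundary $\partial_h(X)$ is homeomorphic to the circle $S^1$, and it is parametrized by the geodesic rays $\alpha^{*}$ (four axial rays) and $\alpha^{*}_m$ (eight families, $m\ge 0$) defined in the context. That is, the points of $\partial_h(X)$ are exactly the limits $h^{*}$, $h^{*}_m$ of these rays, namely $$h^{\rm N}=-y,\quad h^{\rm S}=y,\quad h^{\rm E}=-x,\quad h^{\rm W}=x,$$ $$h^{\rm NE}_m=\max(-x-m,-y),\qquad h^{\rm EN}_m=\max(-x,-y-m),$$ $$h^{\rm NW}_m=\max(x-m,-y),\qquad h^{\rm WN}_m=\max(x,-y-m),$$ $$h^{\rm SE}_m=\max(-x-m,y),\qquad h^{\rm ES}_m=\max(-x,y-m),$$ $$h^{\rm SW}_m=\max(x-m,y),\qquad h^{\rm WS}_m=\max(x,y-m),$$ for $m\ge 0$, which are pairwise distinct except that $h^{\rm NE}_0=h^{\rm EN}_0$, $h^{\rm NW}_0=h^{\rm WN}_0$, $h^{\rm SE}_0=h^{\rm ES}_0$, $h^{\rm SW}_0=h^{\rm WS}_0$. Around the circle, these are arranged so that each family $h^{PQ}_m$ ($P,Q$ adjacent axial directions) fills, as $m$ goes from $0$ to $\infty$, the arc from the diagonal point $h^{PQ}_0$ to the axial point $h^{P}$, the axial points occurring in the cyclic order N, E, S, W.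
   Context: The sup metric is $d((x,y),(x',y'))=\max(|x-x'|,|y-y'|)$. Horofunction boundary: for a proper geodesic metric space $X$ with basepoint $x_0$, embed $X$ in the space $C(X)$ of continuous real functions (topology of uniform convergence on compact sets) by $\Psi(z)=d(z,\cdot)-d(z,x_0)$; then $\partial_h(X)=\overline{\Psi(X)}\setminus\Psi(X)$ with the subspace topology. Geodesics: $\alpha^{\rm N}(t)=(0,t)$, $\alpha^{\rm S}(t)=(0,-t)$, $\alpha^{\rm E}(t)=(t,0)$, $\alpha^{\rm W}(t)=(-t,0)$ for $t\ge0$. For $m\ge 0$, $\alpha^{\rm NE}_m(t)=(\max(0,t-m),t)$, which travels north for $m$ units and then diagonally northeast. The other seven families $\alpha^{\rm NW}_m,\alpha^{\rm EN}_m,\alpha^{\rm ES}_m,\alpha^{\rm SE}_m,\alpha^{\rm SW}_m,\alpha^{\rm WN}_m,\alpha^{\rm WS}_m$ are defined similarly: $\alpha^{PQ}_m$ travels in the axial direction $P$ for $m$ units, then turns by $\pi/4$ towards the axial direction $Q$ and continues diagonally. Write $h^{*}$ and $h^{*}_m$ for the horofunctions $\lim_{t\to\infty}\Psi(\alpha^{*}(t))$ and $\lim_{t\to\infty}\Psi(\alpha^{*}_m(t))$. *)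

(* Defs.v *)
From HB Require Import structures.
From mathcomp Require Import all_boot all_order all_algebra.
From mathcomp Require Import all_classical all_reals all_analysis.
From mathcomp Require Import lra.
Set Implicit Arguments.
Unset Strict Implicit.
Unset Printing Implicit Defensive.
Import Order.TTheory GRing.Theory Num.Theory numFieldNormedType.Exports.
Local Open Scope classical_set_scope.
Local Open Scope ring_scope.

Definition homeomorphism (S T : topologicalType) (f : S -> T) : Prop :=
  continuous f /\ exists g : T -> S, [/\ cancel f g, cancel g f & continuous g].

(* C(X), with the topology of uniform convergence on compact sets *)
Definition Cspace (R : realType) (X : metricType R) : Type := continuousType X R.

HB.instance Definition _ (R : realType) (X : metricType R) :=
  Topological.copy (Cspace X)
    (initial_topology (id : continuousType X R -> {family compact, X -> R})).

Section horofunction_boundary.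
Context {R : realType} {X : metricType R}.

Definition geodesic_ray (a : R -> X) : Prop :=
  forall s t : R, 0 <= s -> 0 <= t -> mdist (a s) (a t) = `|s - t|.

Lemma continuous_Psi (x0 z : X) :
  continuous (fun x : X => mdist z x - mdist z x0 : R).
Proof.
move=> x; apply/(@cvgrPdist_lt R R) => e e0; near=> y.
have xy : mdist x y < e.
  by near: y; have := nbhsx_ballx x e e0; rewrite ballEmdist.
rewrite opprB addrA subrK ltr_norml.
have := metric_triangle z x y; have := metric_triangle z y x.
by rewrite (metric_sym y x) => ? ?; lra.
Unshelve. all: by end_near. Qed.

Definition Psi (x0 z : X) : Cspace X := mkcts (@continuous_Psi x0 z).

Definition horoboundary (x0 : X) : set (Cspace X) :=
  closure (range (Psi x0)) `\` range (Psi x0).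

End horofunction_boundary.

Section sup_metric.
Variable R : realType.
Implicit Types p q : R * R.

Definition sup_dist p q : R := Num.max `|p.1 - q.1| `|p.2 - q.2|.

Lemma sup_dist_ge0 p q : 0 <= sup_dist p q.
Proof. by rewrite le_max normr_ge0. Qed.

Lemma sup_dist_positivity p q : sup_dist p q = 0 -> p = q.
Proof.
case: p q => [x y] [x' y'] /eqP; rewrite eq_le ge_max /= !normr_le0 !subr_eq0.
by case/andP => /andP[/eqP -> /eqP ->].
Qed.

Lemma sup_ballE p (e : R) : ball p e = [set q | sup_dist p q < e].
Proof. by apply/seteqP; split => q /=; rewrite gt_max => /andP. Qed.

HB.instance Definition _ := PseudoMetric_isMetric.Build R (R * R)%type
  sup_dist_ge0 sup_dist_positivity sup_ballE.

End sup_metric.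

Inductive axis := North | East | South | West.

(* [PQ] starts in the axial direction P and turns towards Q. *)
Inductive turn := NE | NW | EN | ES | SE | SW | WN | WS.

Definition initial (a : turn) : axis :=
  match a with
  | NE | NW => North | EN | ES => East | SE | SW => South | WN | WS => West
  end.

Definition target (a : turn) : axis :=
  match a with
  | EN | WN => North | NE | SE => East | ES | WS => South | NW | SW => West
  end.

Definition swap (a : turn) : turn :=
  match a with
  | NE => EN | NW => WN | EN => NE | ES => SE
  | SE => ES | SW => WS | WN => NW | WS => SW
  end.

Section sup_plane.
Variable R : realType.

Definition unit_vector (P : axis) : R * R :=
  match P with
  | North => (0, 1) | East => (1, 0) | South => (0, -1) | West => (-1, 0)
  end.

Definition axial_ray (P : axis) (t : R) : R * R := t *: unit_vector P.

(* For [NE] this is (max 0 (t - m), t). *)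
Definition turning_ray (a : turn) (m t : R) : R * R :=
  t *: unit_vector (initial a) + Num.max 0 (t - m) *: unit_vector (target a).

Definition axial_fun (P : axis) (p : R * R) : R :=
  match P with
  | North => - p.2 | East => - p.1 | South => p.2 | West => p.1
  end.

Definition turning_fun (a : turn) (m : R) (p : R * R) : R :=
  match a with
  | NE => Num.max (- p.1 - m) (- p.2)
  | EN => Num.max (- p.1) (- p.2 - m)
  | NW => Num.max (p.1 - m) (- p.2)
  | WN => Num.max p.1 (- p.2 - m)
  | SE => Num.max (- p.1 - m) p.2
  | ES => Num.max (- p.1) (p.2 - m)
  | SW => Num.max (p.1 - m) p.2
  | WS => Num.max p.1 (p.2 - m)
  end.

Lemma continuous_axial_fun P : continuous (axial_fun P).
Proof.
case: P => p /=; first [exact: cvg_snd | exact: cvg_fst | apply: cvgN];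
  first [exact: cvg_snd | exact: cvg_fst].
Qed.

Lemma continuous_turning_fun a m : continuous (turning_fun a m).
Proof.
have mx (f g : R * R -> R) : continuous f -> continuous g ->
  continuous (fun p => Num.max (f p) (g p)).
  by move=> cf cg p; apply: continuous_max; [exact: cf | exact: cg].
have cB (f : R * R -> R) : continuous f -> continuous (fun p => f p - m).
  by move=> cf p; apply: cvgB; [exact: cf | exact: cvg_cst].
have cx : continuous (fun p : R * R => p.1) by move=> p; exact: cvg_fst.
have cy : continuous (fun p : R * R => p.2) by move=> p; exact: cvg_snd.
have cNx : continuous (fun p : R * R => - p.1) by move=> p; apply: cvgN; exact: cx.
have cNy : continuous (fun p : R * R => - p.2) by move=> p; apply: cvgN; exact: cy.
by case: a; apply: mx => //; exact: cB.
Qed.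

Definition axial_horo (P : axis) : Cspace (R * R)%type :=
  mkcts (@continuous_axial_fun P).

Definition turning_horo (a : turn) (m : R) : Cspace (R * R)%type :=
  mkcts (@continuous_turning_fun a m).

Definition circle : set (R * R) := [set p | p.1 ^+ 2 + p.2 ^+ 2 = 1].

Lemma circle_sin_cos (t : R) : (sin t, cos t) \in circle.
Proof. by apply/mem_set; rewrite /circle/= addrC cos2Dsin2. Qed.

(* Angles are compass bearings: 0 is (0, 1), and they increase clockwise. *)
Definition bearing (t : R) : circle := exist _ (sin t, cos t) (circle_sin_cos t).

Definition axis_angle (P : axis) : R :=
  match P with
  | North => 0 | East => pi / 2 | South => pi | West => 3 * pi / 2
  end.

(* 1 if the target is the clockwise neighbour of the initial axis, -1 otherwise *)
Definition orientation (a : turn) : R :=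
  match a with NE | ES | SW | WN => 1 | NW | EN | SE | WS => -1 end.

End sup_plane.

Arguments circle R : clear implicits.
Arguments axial_ray R P t : clear implicits.
Arguments turning_ray R a m t : clear implicits.

(* Main.v *)
Require Import Defs.
From mathcomp Require Import all_boot all_order all_algebra.
From mathcomp Require Import all_classical all_reals all_analysis.
From mathcomp Require Import lra.
Import Order.TTheory GRing.Theory Num.Theory numFieldNormedType.Exports.
Local Open Scope classical_set_scope.
Local Open Scope ring_scope.
Set Implicit Arguments.
Unset Strict Implicit.
Unset Printing Implicit Defensive.

(** For a point [z] write |z| for its sup norm, and let [A_P] be the linear
    function [axial_fun P], that is, minus the coordinate in the direction
    [P].  Since d(z, q) is the maximum over the four axial directions of
    A_P(q) - A_P(z), the function [Psi 0 z] is the maximum of the four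
    functions A_P - s_P(z), where the slack s_P(z) = |z| + A_P(z) is
    nonnegative ([Psi_le]).  At every [z] some slack is 0, and opposite slacks
    add up to 2|z|.

    When [z] goes to infinity, the limit of [Psi 0 z] is thus governed by the
    limits of the four slacks in [0, +oo].  Say that s_P = 0.  The slack of the
    direction opposite to [P] tends to infinity, and of the two directions
    perpendicular to [P] at most one keeps a bounded slack.  If its slack tends
    to [m], the limit is the maximum of A_P and A_Q - m, a turning
    horofunction ([cvg_Psi_turning]); if there is none, the limit is A_P, an
    axial horofunction ([cvg_Psi_axial]).  Along an ultrafilter every slack has
    a limit, so nothing else occurs in the closure of the image of [Psi]
    ([Psi_ultra_limit]), while all these limits do occur along the given rays.
    They are unbounded below, unlike the functions [Psi 0 z], so they form
    exactly the boundary ([horoboundary_plane]).  Their values at four points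
    of the axes tell them apart ([turning_horo_eq]).

    For the circle, project a point c radially to the square of sup norm 1,
    and let t_P(c) be its coordinate in the direction [P].  Attach to c the
    maximum of A_P + 1 - 1/t_P(c) over the directions with t_P(c) > 0.  On the
    arc from the diagonal point between [P] and [Q] to the point [P] one has
    t_P = 1, and t_Q decreases from 1 to 0, so this is the turning
    horofunction with delay m = 1/t_Q - 1, and the axial one at the end of the
    arc; t_Q is the tangent of the angle from [P], whence the angle
    atan (1/(1 + m)).  Cutting off t_P from below ([compass]) makes the value
    at a fixed q visibly continuous in c.  All functions involved are
    1-Lipschitz, so by equicontinuity pointwise convergence is convergence in
    C(X) ([cvg_Cspace_pointwise]), and the map from the circle to the boundary
    is continuous.  Being a bijection from a compact space to a Hausdorff one,
    it is a homeomorphism. *)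

(** * Topology *)

Lemma cvg_initial (S : choiceType) (T : topologicalType) (j : S -> T)
    (F : set_system S) (s : S) : Filter F ->
  j @ F --> j s -> F --> (s : initial_topology j).
Proof.
move=> FF jF A [_ [[B oB <-] Bs BA]].
by apply: (filterS BA); apply: jF; exact: open_nbhs_nbhs.
Qed.

(** A continuous map from a compact space to a Hausdorff one is closed. *)
Lemma compact_hausdorff_homeomorphism (S T : topologicalType) (f : S -> T) :
  compact [set: S] -> hausdorff_space T -> continuous f -> bijective f ->
  homeomorphism f.
Proof.
move=> cS hT cf [g fK gK]; split=> //; exists g; split=> //.
apply/continuous_closedP => A cA.
have -> : g @^-1` A = f @` A.
  by apply/seteqP; split=> [t At|_ [s As <-]] /=; [exists (g t)|rewrite fK].
apply: (compact_closed hT); apply: continuous_compact.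
  exact: continuous_subspaceT.
exact: (subclosed_compact cA cS).
Qed.

Lemma hausdorff_set_type (T : topologicalType) (A : set T) :
  hausdorff_space T -> hausdorff_space A.
Proof.
move=> hT x y xy; apply: val_inj; apply: hT => B C Bx Cy.
have cval := @initial_continuous A T set_val.
have [z [/= Bz Cz]] := xy _ _ (cval x _ Bx) (cval y _ Cy).
by exists (set_val z).
Qed.

(** For every [A], the preimage of [A] or that of its complement belongs to
    [F], so the pushforward has no proper refinement. *)
Lemma ultra_fmap (T U : Type) (f : T -> U) (F : set_system T) :
  UltraFilter F -> UltraFilter (f @ F).
Proof.
move=> FU; split=> [|G GF FG]; first exact: fmap_proper_filter.
apply/seteqP; split=> // A GA.
have [//|FnA] := in_ultra_setVsetC (f @^-1` A) FU.
have GnA := FG (~` A) FnA.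
by have [x [Ax /(_ Ax)]] := filter_ex (filterI GA GnA).
Qed.

(** An ultrafilter on the subtype, pushed forward, converges to a point of
    [A]; for the initial topology this is convergence in the subtype. *)
Lemma compact_set_type (T : topologicalType) (A : set T) :
  compact A -> compact [set: A].
Proof.
rewrite !compact_ultra => cA F FU _.
have FA : F (set_val @^-1` A : set A).
  by apply: filterS (@filterT _ F _) => x _; exact: set_valP.
have [x [Ax Fx]] := cA _ (ultra_fmap set_val FU) FA.
exists (exist _ x (mem_set Ax)); split=> //.
exact: cvg_initial.
Qed.

Lemma closure_range_cvg (T U : Type) (S : topologicalType) (F : set_system T)
    (z : T -> U) (f : U -> S) (l : S) :
  ProperFilter F -> f (z x) @[x --> F] --> l -> closure (range f) l.
Proof.
move=> FF fl B /fl FB.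
have [x Bx] := filter_ex (FB : F [set x | B (f (z x))]).
by exists (f (z x)); split=> //; exists (z x).
Qed.

Lemma compact_circle (R : realType) : compact (circle R).
Proof.
apply: (@subclosed_compact _ (circle R) (`[-1 : R, 1] `*` `[-1 : R, 1])).
- have -> : circle R =
      (fun p : R * R => p.1 ^+ 2 + p.2 ^+ 2) @^-1` [set 1] by [].
  apply: preimage_closed; last exact: closed_eq.
  move=> p _; apply: cvgD; rewrite expr2; apply: cvgM;
    first [exact: cvg_fst | exact: cvg_snd].
- by apply: compact_setX; exact: segment_compact.
- move=> [x y]; rewrite /circle /= !expr2 => c.
  by split; rewrite /= in_itv /=; apply/andP; split; nra.
Qed.

(** * Convergence of 1-Lipschitz functions in C(X) *)

Section Cspace_topology.
Context {R : realType} {X : metricType R}.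
Implicit Types (h : Cspace X) (f : X -> R).

Definition lipschitz1 f := forall x y, f y - f x <= mdist x y.

Lemma lipschitz1_dist f x y : lipschitz1 f -> `|f x - f y| <= mdist x y.
Proof.
move=> Lf; rewrite ler_norml; have := Lf x y; have := Lf y x.
by rewrite (metric_sym y x); lra.
Qed.

Lemma PsiE (x0 z x : X) : Psi x0 z x = mdist z x - mdist z x0 :> R.
Proof. by []. Qed.

Lemma lipschitz1_Psi (x0 z : X) : lipschitz1 (Psi x0 z).
Proof. by move=> x y; rewrite !PsiE; have := metric_triangle z x y; lra. Qed.

Lemma equicontinuous_lipschitz1 :
  equicontinuous (lipschitz1 : set (X -> R)) id.
Proof.
move=> x E; rewrite -entourage_ballE => -[e /= e0 sE].
near=> y => f Lf; apply: sE => /=; rewrite /ball /=.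
apply: (le_lt_trans (lipschitz1_dist _ _ Lf)).
by near: y; have := nbhsx_ballx x e e0; rewrite ballEmdist.
Unshelve. all: by end_near. Qed.

(** The Arzela-Ascoli principle: on an equicontinuous family pointwise
    convergence is uniform on compact sets.  All convergences in C(X) below are
    reduced to limits of real numbers through it. *)
Lemma cvg_Cspace_pointwise {T : Type} (F : set_system T) (f : T -> Cspace X) h :
  ProperFilter F -> (forall t, lipschitz1 (f t)) ->
  (forall x, f t x @[t --> F] --> h x) -> f @ F --> h.
Proof.
move=> FF Lf fh.
apply: (@cvg_initial (continuousType X R) {family compact, X -> R}
  (fun u => u) (f @ F) h).
pose g := fun t => f t : X -> R.
change ({family compact, (g @ F) --> (h : X -> R)}).
apply: (iffLR (@pointwise_compact_cvg X R (g @ F) h _ _)).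
  apply/near_powerset_filter_fromP.
    exact: equicontinuous_subset_id.
  by exists lipschitz1; [exact: nearW|exact: equicontinuous_lipschitz1].
exact/pointwise_cvgP.
Qed.

Lemma continuous_eval (x : X) : continuous (fun h : Cspace X => h x).
Proof.
move=> h.
have : {family compact, (fun g : Cspace X => g : X -> R) @ nbhs h --> (h : X -> R)}.
  exact: (@initial_continuous (continuousType X R) {family compact, X -> R} (fun u => u) h).
by move/pointwise_cvg_compact_family/pointwise_cvgP; apply.
Qed.

(** Evaluations are continuous and separate the elements of C(X). *)
Lemma hausdorff_Cspace : hausdorff_space (Cspace X).
Proof.
move=> g h gh; apply/continuousEP => x; apply: (@Rhausdorff R) => A B Ag Bh.
have /continuous_eval gA := Ag; have /continuous_eval hB := Bh.
have [u [/= Au Bu]] := gh _ _ gA hB.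
by exists (u x).
Qed.

Lemma continuous_Psi_center (x0 : X) :
  continuous (Psi x0).
Proof.
have cd (x : X) : continuous (fun z : X => mdist z x : R).
  move=> z; apply/(@cvgrPdist_lt R R) => e e0; near=> y.
  have zy : mdist z y < e.
    by near: y; have := nbhsx_ballx z e e0; rewrite ballEmdist.
  rewrite ltr_norml; have := metric_triangle z y x.
  by have := metric_triangle y z x; rewrite (metric_sym y z); lra.
move=> z; apply: cvg_Cspace_pointwise => [y|x]; first exact: lipschitz1_Psi.
by apply: (@cvgB R R); exact: cd.
Unshelve. all: by end_near. Qed.

(** The defining inequalities pass to pointwise limits; in particular boundary
    functions are 1-Lipschitz, as [cvg_Cspace_pointwise] requires. *)
Lemma lipschitz1_closure (x0 : X) (h : Cspace X) :
  closure (range (Psi x0)) h -> lipschitz1 h.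
Proof.
rewrite closureEcvg => -[G PG [Gh sG]] x y.
have cxy : (g y - g x : R) @[g --> G] --> h y - h x.
  by apply: cvgB; exact: (cvg_comp _ _ Gh (@continuous_eval _ h)).
apply: (closed_cvg _ (@closed_le R (mdist x y)) _ _ cxy).
by apply: sG => _ [z _ <-]; exact: lipschitz1_Psi.
Qed.

End Cspace_topology.

(** * The functions Psi z as maxima of four affine functions *)

Section sup_plane.
Variable R : realType.
Implicit Types (P Q : axis) (a : turn) (z q : R * R) (m b : R).

Definition opposite P :=
  match P with North => South | South => North | East => West | West => East end.

Lemma axial_fun_opposite P q : axial_fun (opposite P) q = - axial_fun P q.
Proof. by case: P; rewrite /= ?opprK. Qed.

(** The two directions of a turn and their opposites exhaust the axes, so that
    arguments about all eight families can be made at once. *)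
Lemma axis_of_turn a P :
  [\/ P = initial a, P = opposite (initial a),
      P = target a | P = opposite (target a)].
Proof.
by case: a; case: P; first [exact: Or41|exact: Or42|exact: Or43|exact: Or44].
Qed.

Lemma turning_funE a m q :
  turning_fun a m q =
  Num.max (axial_fun (initial a) q) (axial_fun (target a) q - m).
Proof. by case: a => //=; rewrite maxC. Qed.

Definition sup_norm z := Num.max `|z.1| `|z.2|.

Lemma sup_norm_le z b :
  sup_norm z <= b <-> forall P, axial_fun P z <= b.
Proof.
rewrite /sup_norm ge_max !ler_norml; split=> [H|H].
  by case=> /=; lra.
have := H North; have := H South; have := H East; have := H West => /=; lra.
Qed.

Lemma axial_fun_le_norm P z : axial_fun P z <= sup_norm z.
Proof. exact: (iffLR (sup_norm_le z _)). Qed.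

Lemma sup_norm_ge0 z : 0 <= sup_norm z.
Proof. by rewrite /sup_norm le_max normr_ge0. Qed.

(** The excess of the sup norm over the coordinate in the direction [P]. *)
Definition slack P z := sup_norm z + axial_fun P z.

Lemma slack_ge0 P z : 0 <= slack P z.
Proof.
by have := axial_fun_le_norm (opposite P) z; rewrite axial_fun_opposite /slack; lra.
Qed.

Lemma slack_opposite P z : slack (opposite P) z = 2 * sup_norm z - slack P z.
Proof. by rewrite /slack axial_fun_opposite; lra. Qed.

(** The sup norm is attained by a coordinate, up to sign. *)
Lemma slack_eq0 z : exists P, slack P z = 0.
Proof.
rewrite /slack /sup_norm; case: lerP => _.
- case: (ger0P z.2) => _; [exists North|exists South] => /=; lra.
- case: (ger0P z.1) => _; [exists East|exists West] => /=; lra.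
Qed.

(** Since |x| is the maximum of x and -x, the sup distance to [q] is the
    maximum of four affine functions of [q]; this is the universal property of
    that maximum. *)
Lemma Psi_le z q b : Psi ((0, 0) : R * R) z q <= b <->
  forall P, axial_fun P q - slack P z <= b.
Proof.
have -> : Psi ((0, 0) : R * R) z q = sup_norm (q.1 - z.1, q.2 - z.2) - sup_norm z.
  rewrite PsiE /mdist /= /sup_dist /sup_norm /=.
  by rewrite !subr0 (distrC z.1) (distrC z.2).
rewrite lerBlDr sup_norm_le; split=> H P; have := H P; rewrite /slack;
  by case: P => /=; lra.
Qed.

Lemma Psi_axial P z q : slack P z = 0 ->
  (forall Q, Q <> P -> axial_fun Q q - slack Q z <= axial_fun P q) ->
  Psi ((0, 0) : R * R) z q = axial_fun P q.
Proof.
move=> s0 H; apply/le_anti/andP; split.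
  apply/Psi_le => Q; have [->|/H//] := pselect (Q = P).
  by rewrite s0 subr0.
by have /Psi_le/(_ P) := lexx (Psi ((0, 0) : R * R) z q); rewrite s0 subr0.
Qed.

(** For a given [q] the directions opposite to those of the turn do not matter
    once |z| is large, because slacks of opposite directions add up to 2|z|. *)
Lemma Psi_turning a z q :
  slack (initial a) z = 0 -> - axial_fun (initial a) q <= sup_norm z ->
  slack (target a) z - axial_fun (initial a) q - axial_fun (target a) q
    <= 2 * sup_norm z ->
  Psi ((0, 0) : R * R) z q = turning_fun a (slack (target a) z) q.
Proof.
move=> s0 nP nQ; rewrite turning_funE; apply/le_anti/andP; split.
  apply/Psi_le => P; rewrite le_max; case: (axis_of_turn a P) => ->.
  - by rewrite s0 subr0 lexx.
  - by rewrite slack_opposite axial_fun_opposite s0; apply/orP; left; lra.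
  - by rewrite lexx orbT.
  - by rewrite slack_opposite axial_fun_opposite; apply/orP; left; lra.
have /Psi_le H := lexx (Psi ((0, 0) : R * R) z q).
by rewrite ge_max H andbT; have := H (initial a); rewrite s0 subr0.
Qed.

(** * Limits of Psi along a filter *)

Lemma continuous_turning_fun_delay a q : continuous (fun m : R => turning_fun a m q).
Proof.
move=> m; under eq_fun do rewrite turning_funE.
apply: (@continuous_max R R^o (fun=> axial_fun (initial a) q)
  (fun m => axial_fun (target a) q - m)); first exact: cvg_cst.
by apply: cvgB; [exact: cvg_cst|exact: cvg_id].
Qed.

Section limits_of_Psi.
Context {T : Type} (F : set_system T) {FF : ProperFilter F} (z : T -> R * R).

(** At a given point only the direction [P] contributes eventually. *)
Lemma cvg_Psi_axial P :
  (\forall t \near F, slack P (z t) = 0) ->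
  (forall Q, Q <> P -> slack Q (z t) @[t --> F] --> +oo) ->
  Psi ((0, 0) : R * R) (z t) @[t --> F] --> axial_horo R P.
Proof.
move=> s0 soo; apply: cvg_Cspace_pointwise => [t|q]; first exact: lipschitz1_Psi.
have H Q : \forall t \near F,
    Q <> P -> axial_fun Q q - slack Q (z t) <= axial_fun P q.
  have [->|/soo/cvgryPge sQ] := pselect (Q = P); first by apply: nearW.
  apply: filterS (sQ (axial_fun Q q - axial_fun P q)) => t ? _; lra.
apply: cvg_near_cst; near=> t; apply: Psi_axial; first by near: t.
by move=> Q; case: Q; near: t; exact: H.
Unshelve. all: by end_near. Qed.

(** At a given point [Psi (z t)] is eventually the turning function whose
    delay is the current slack of the target direction. *)
Lemma cvg_Psi_turning a m :
  (\forall t \near F, slack (initial a) (z t) = 0) ->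
  sup_norm (z t) @[t --> F] --> +oo ->
  slack (target a) (z t) @[t --> F] --> m ->
  Psi ((0, 0) : R * R) (z t) @[t --> F] --> turning_horo a m.
Proof.
move=> s0 noo sm; apply: cvg_Cspace_pointwise => [t|q]; first exact: lipschitz1_Psi.
have := cvg_comp _ _ sm (@continuous_turning_fun_delay a q m).
apply: cvg_trans; apply: near_eq_cvg; near=> t => /=.
apply/esym/Psi_turning; first by near: t.
- by near: t; move/cvgryPge : noo; apply.
- have : slack (target a) (z t) < m + 1 by near: t; apply: (cvgr_lt m) => //; lra.
  have : m + 1 - axial_fun (initial a) q - axial_fun (target a) q <= sup_norm (z t).
    by near: t; move/cvgryPge : noo; apply.
  by have := sup_norm_ge0 (z t); lra.
Unshelve. all: by end_near. Qed.

End limits_of_Psi.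

(** * Geodesic rays *)

Implicit Types s r : R.

(** The eight closed octants of the plane are the images of 0 <= r <= s under
    the maps [sector a].  Rays and points of the circle are handled in these
    coordinates, which treat all eight families alike. *)
Definition sector a (s r : R) : R * R :=
  s *: unit_vector R (initial a) + r *: unit_vector R (target a).

Lemma sectorE a s r : sector a s r =
  match a with
  | NE => (r, s) | NW => (- r, s) | EN => (s, r) | ES => (s, - r)
  | SE => (r, - s) | SW => (- r, - s) | WN => (- s, r) | WS => (- s, - r)
  end.
Proof.
rewrite [LHS]surjective_pairing.
by case: a; congr pair; rewrite /sector /= /GRing.scale /=; lra.
Qed.

Lemma axial_fun_initial_sector a s r :
  axial_fun (initial a) (sector a s r) = - s.
Proof. by case: a; rewrite /sector /= /GRing.scale /=; lra. Qed.

Lemma axial_fun_target_sector a s r :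
  axial_fun (target a) (sector a s r) = - r.
Proof. by case: a; rewrite /sector /= /GRing.scale /=; lra. Qed.

Lemma sup_dist_sector a (s r s' r' : R) :
  sup_dist (sector a s r) (sector a s' r') = Num.max `|s - s'| `|r - r'|.
Proof.
rewrite /sup_dist /sector; case: a; rewrite /GRing.scale /= /GRing.scale /=;
  rewrite !(mulr0, mulr1, mulrN1, addr0, add0r, subr0) -?opprD ?normrN // maxC //.
Qed.

Lemma sup_norm_sector a s r : 0 <= r <= s -> sup_norm (sector a s r) = s.
Proof.
move=> rs; apply/le_anti/andP; split; last first.
  by have := axial_fun_le_norm (opposite (initial a)) (sector a s r);
    rewrite axial_fun_opposite axial_fun_initial_sector opprK.
apply/sup_norm_le => P; have := axial_fun_initial_sector a s r.
have := axial_fun_target_sector a s r.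
by case: (axis_of_turn a P) => ->; rewrite ?axial_fun_opposite; lra.
Qed.

Lemma slack_initial_sector a s r : 0 <= r <= s ->
  slack (initial a) (sector a s r) = 0.
Proof. by move=> rs; rewrite /slack sup_norm_sector// axial_fun_initial_sector subrr. Qed.

Lemma slack_target_sector a s r : 0 <= r <= s ->
  slack (target a) (sector a s r) = s - r.
Proof. by move=> rs; rewrite /slack sup_norm_sector// axial_fun_target_sector. Qed.

Lemma turn_from P : exists a, initial a = P.
Proof. by case: P; [exists NE|exists EN|exists SE|exists WN]. Qed.

Lemma axis_neq P Q : Q <> P ->
  Q = opposite P \/ exists a, initial a = P /\ target a = Q.
Proof.
case: P; case: Q => // _; try (by left); right;
  by [exists NE|exists NW|exists EN|exists ES|exists SE|exists SW|exists WN|exists WS].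
Qed.

Lemma axial_ray_sector a (t : R) : axial_ray R (initial a) t = sector a t 0.
Proof. by rewrite /axial_ray /sector scale0r addr0. Qed.

Lemma turning_ray_sector a m (t : R) : turning_ray R a m t = sector a t (Num.max 0 (t - m)).
Proof. by []. Qed.

Lemma geodesic_axial_ray P :
  axial_ray R P 0 = (0, 0) /\ geodesic_ray (axial_ray R P).
Proof.
split; first by rewrite /axial_ray scale0r.
have [a <-] := turn_from P => s t _ _; rewrite !axial_ray_sector.
by rewrite /mdist /= sup_dist_sector subrr normr0 max_l.
Qed.

(** The coordinate in the initial direction has unit speed and the other one
    is a 1-Lipschitz function of time, so the former realizes the distance. *)
Lemma geodesic_turning_ray a m : 0 <= m ->
  turning_ray R a m 0 = (0, 0) /\ geodesic_ray (turning_ray R a m).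
Proof.
move=> m0; split.
  by rewrite /turning_ray max_l ?scale0r ?addr0 // sub0r oppr_le0.
move=> s t s0 t0; rewrite !turning_ray_sector /mdist /= sup_dist_sector max_l //.
have := ler_norm (s - t); have := ler_norm (t - s); rewrite (distrC t) ler_norml.
by case: (lerP 0 (s - m)) => ?; case: (lerP 0 (t - m)) => ?; lra.
Qed.

Lemma cvg_axial_ray P :
  Psi ((0, 0) : R * R) (axial_ray R P t) @[t --> +oo%R] --> axial_horo R P.
Proof.
have t00 : \forall t \near +oo%R, 0 <= (0 : R) <= t.
  by near=> t; rewrite lexx /=; near: t; exact: nbhs_pinfty_ge (num_real _).
apply: cvg_Psi_axial => [|Q QP].
  have [a <-] := turn_from P; apply: filterS t00 => t t0.
  by rewrite axial_ray_sector slack_initial_sector.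
apply/cvgryPge => A; near=> t.
have t0 : 0 <= (0 : R) <= t by near: t.
apply: (@le_trans _ _ t); first by near: t; exact: nbhs_pinfty_ge (num_real _).
have [->|[a [<- <-]]] := axis_neq QP.
  have [a <-] := turn_from P.
  rewrite axial_ray_sector slack_opposite slack_initial_sector // sup_norm_sector //; lra.
by rewrite axial_ray_sector slack_target_sector // subr0.
Unshelve. all: by end_near. Qed.

Lemma cvg_turning_ray a m : 0 <= m ->
  Psi ((0, 0) : R * R) (turning_ray R a m t) @[t --> +oo%R] --> turning_horo a m.
Proof.
move=> m0.
have tm : \forall t \near +oo%R, 0 <= t - m <= t /\ Num.max 0 (t - m) = t - m.
  near=> t; have ? : m <= t by near: t; exact: nbhs_pinfty_ge (num_real _).
  by rewrite max_r; [split=> //; lra|lra].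
apply: cvg_Psi_turning.
- by apply: filterS tm => t [tm E]; rewrite turning_ray_sector E slack_initial_sector.
- apply/cvgryPge => A; near=> t.
  have [t0 E] : 0 <= t - m <= t /\ Num.max 0 (t - m) = t - m by near: t.
  by rewrite turning_ray_sector E sup_norm_sector //; near: t; exact: nbhs_pinfty_ge (num_real _).
- apply: cvg_near_cst; apply: filterS tm => t [tm E].
  by rewrite turning_ray_sector E slack_target_sector //; lra.
Unshelve. all: by end_near. Qed.

(** * The points of the boundary *)

Section ultrafilter_limits.
Context {T : Type} (F : set_system T) {FU : UltraFilter F}.

Lemma ultra_bounded_cvg (f : T -> R) (B : R) :
  (\forall t \near F, `|f t| <= B) -> exists l : R, f @ F --> l.
Proof.
move=> fB; have := @segment_compact R (- B) B; rewrite compact_ultra.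
case/(_ _ (ultra_fmap f FU)) => [|l [_ fl]]; last by exists l.
by apply: filterS fB => t /=; rewrite in_itv /= ler_norml.
Qed.

(** Compactness of the half-line [0, +oo], for ultrafilters. *)
Lemma ultra_ge0_cvg (f : T -> R) : (forall t : T, 0 <= f t) ->
  (exists2 l : R, 0 <= l & f @ F --> l) \/ f @ F --> +oo.
Proof.
move=> f0; have [[B fB]|nB] := pselect (exists B, \forall t \near F, f t <= B).
  left; have [|l fl] := @ultra_bounded_cvg f B.
    by apply: filterS fB => t; rewrite ger0_norm.
  by exists l => //; exact: (closed_cvg _ (@closed_ge R 0) (nearW _ f0) _ fl).
right; apply/cvgryPge => A.
have [fA|] := in_ultra_setVsetC [set t | f t <= A] FU.
  by exfalso; apply: nB; exists A.
by apply: filterS => t /= /negP; rewrite -ltNge => /ltW.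
Qed.

(** Either |z| stays bounded along [F], then [z] converges and [h] is the value
    of [Psi] at its limit; or |z| tends to infinity, and the limits of the
    slacks determine [h]. *)
Lemma Psi_ultra_limit (z : T -> R * R) h :
  Psi ((0, 0) : R * R) (z t) @[t --> F] --> h ->
  range (Psi ((0, 0) : R * R)) h \/
  (range (axial_horo R) `|`
    [set g | exists a m, 0 <= m /\ g = turning_horo a m]) h.
Proof.
move=> zh.
have uniq g : Psi ((0, 0) : R * R) (z t) @[t --> F] --> g -> h = g.
  by move=> zg; exact: (cvg_unique (@hausdorff_Cspace R (R * R)%type) zh zg).
have [[B _ nB]|noo] := ultra_ge0_cvg (fun t : T => sup_norm_ge0 (z t)).
  left.
  have bnd : \forall t \near F, sup_norm (z t) <= B + 1.
    by apply: (cvgr_le B) => //; lra.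
  have [u zu] : exists u : R, (z t).1 @[t --> F] --> u.
    apply: (@ultra_bounded_cvg _ (B + 1)); apply: filterS bnd => t.
    by apply: le_trans; rewrite /sup_norm le_max lexx.
  have [v zv] : exists v : R, (z t).2 @[t --> F] --> v.
    apply: (@ultra_bounded_cvg _ (B + 1)); apply: filterS bnd => t.
    by apply: le_trans; rewrite /sup_norm le_max lexx orbT.
  exists (u, v) => //; apply/esym/uniq.
  have zuv : z t @[t --> F] --> (u, v).
    have -> : z = fun t : T => ((z t).1, (z t).2) by apply/funext => t; case: (z t).
    exact: (cvg_pair zu zv).
  exact: (cvg_comp _ _ zuv (@continuous_Psi_center R (R * R)%type (0, 0) (u, v))).
have [P sP] : exists P, \forall t \near F, slack P (z t) = 0.
  apply: contrapT => nP.
  have nE P : \forall t \near F, slack P (z t) <> 0.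
    have [sP|//] := in_ultra_setVsetC [set t | slack P (z t) = 0] FU.
    by exfalso; apply: nP; exists P.
  have [t [[[n0 s0] e0] w0]] := filter_ex (filterI (filterI (filterI
    (nE North) (nE South)) (nE East)) (nE West)).
  by have [[]] := slack_eq0 (z t).
right.
(* Either some perpendicular direction keeps a bounded slack, or none does. *)
have [[a [aP [m m0 sm]]]|nturn] := pselect (exists a, initial a = P /\
    exists2 m : R, 0 <= m & slack (target a) (z t) @[t --> F] --> m).
  right; exists a, m; split => //; apply: uniq.
  by apply: cvg_Psi_turning => //; rewrite aP.
left; exists P => //; apply/esym/uniq; apply: cvg_Psi_axial => // Q /axis_neq[->|].
  apply/cvgryPge => A; apply: filterS2 sP (cvgry_ge noo `|A|) => t sP nA.
  by rewrite slack_opposite sP; have := ler_norm A; have := normr_ge0 A; lra.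
move=> [a [aP <-]]; have [|//] := ultra_ge0_cvg (fun t : T => slack_ge0 (target a) (z t)).
by move=> lim; exfalso; apply: nturn; exists a.
Qed.

End ultrafilter_limits.

(** [Psi 0 z] is bounded below by -|z|, but an axial horofunction tends to -oo
    along its ray. *)
Lemma axial_horo_notin_range P : ~ range (Psi ((0, 0) : R * R)) (axial_horo R P).
Proof.
move=> [z _ /continuousEP zP]; have [a aP] := turn_from P.
have /Psi_le/(_ (opposite P)) :=
  lexx (Psi ((0, 0) : R * R) z (sector a (sup_norm z + 1) 0)).
rewrite zP axial_fun_opposite -[axial_horo R P _]/(axial_fun P _) slack_opposite.
rewrite -aP axial_fun_initial_sector; have := slack_ge0 (initial a) z; lra.
Qed.

(** The same argument along the diagonal between the two directions of the
    turn, where both terms of the maximum tend to -oo. *)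
Lemma turning_horo_notin_range a m : 0 <= m ->
  ~ range (Psi ((0, 0) : R * R)) (turning_horo a m).
Proof.
move=> m0 [z _ /continuousEP za].
have /Psi_le/(_ (opposite (initial a))) :=
  lexx (Psi ((0, 0) : R * R) z (sector a (sup_norm z + 1) (sup_norm z + 1))).
rewrite za axial_fun_opposite slack_opposite.
rewrite -[turning_horo a m _]/(turning_fun a m _) turning_funE.
rewrite axial_fun_initial_sector axial_fun_target_sector max_l; last lra.
by have := slack_ge0 (initial a) z; lra.
Qed.

(** A point of the closure is a limit of [Psi] along a filter on the image of
    [Psi]; refine it to an ultrafilter and lift it to the plane by choosing
    preimages under [Psi]. *)
Lemma horoboundary_plane : horoboundary ((0, 0) : R * R) =
  range (axial_horo R) `|`
  [set h | exists (a : turn) (m : R), 0 <= m /\ h = turning_horo a m].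
Proof.
apply/seteqP; split => [h [clh nh]|h].
  move: clh; rewrite closureEcvg => -[G PG [Gh sG]].
  have [F [FU GF]] := ultraFilterLemma PG.
  have rF : F (range (Psi ((0, 0) : R * R))) by apply/GF/sG.
  have /choice[z zP] : forall g : Cspace (R * R)%type, exists z : R * R,
      range (Psi ((0, 0) : R * R)) g -> Psi (0, 0) z = g.
    move=> g; have [[z _ <-]|ng] := pselect (range (Psi ((0, 0) : R * R)) g).
      by exists z.
    by exists (0, 0).
  suff zh : Psi ((0, 0) : R * R) (z g) @[g --> F] --> h.
    by have [/nh|] := @Psi_ultra_limit _ F FU z h zh.
  move=> B /Gh/GF FB; have FF : Filter F by exact: ultra_proper.
  by apply: (@filterS _ F FF _ _ _ (@filterI _ F FF _ _ rF FB)) => g [rg Bg];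
    rewrite /= zP.
move=> [[P _ <-]|[a [m [m0 ->]]]]; split.
- exact: closure_range_cvg (@cvg_axial_ray P).
- exact: axial_horo_notin_range.
- exact: closure_range_cvg (cvg_turning_ray m0).
- exact: turning_horo_notin_range.
Qed.

(** * Distinctness *)

(** As soon as [K] is larger than the delay, the values at distance [K] on the
    four half-axes identify the turn and the delay. *)
Lemma turning_fun_axes a m K : 0 <= m <= K ->
  (turning_fun a m (K, 0), turning_fun a m (- K, 0),
   turning_fun a m (0, K), turning_fun a m (0, - K)) =
  match a with
  | NE => (0, K - m, - m, K) | NW => (K - m, 0, - m, K)
  | EN => (- m, K, 0, K - m) | ES => (- m, K, K - m, 0)
  | SE => (0, K - m, K, - m) | SW => (K - m, 0, K, - m)
  | WN => (K, - m, 0, K - m) | WS => (K, - m, K - m, 0)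
  end.
Proof. by move=> mK; case: a => /=; congr (_, _, _, _); case: lerP => ?; lra. Qed.

Lemma axial_horo_inj P Q : axial_horo R P = axial_horo R Q -> P = Q.
Proof.
move=> /continuousEP E; have {}E q : axial_fun P q = axial_fun Q q := E q.
by case: P E; case: Q => // E; exfalso; have := E (1, 0); have := E (0, 1) => /=; lra.
Qed.

Lemma axial_horo_neq_turning P a m : 0 <= m -> axial_horo R P <> turning_horo a m.
Proof.
move=> m0 /continuousEP E; have /(turning_fun_axes a) : 0 <= m <= m + 1 by lra.
have {}E q : turning_fun a m q = axial_fun P q by rewrite -[LHS]E.
by rewrite !E => {}E; case: a E; case: P => /= -[]; lra.
Qed.

Lemma turning_horo_swap a : turning_horo (swap a) 0 = turning_horo a 0 :> Cspace (R * R)%type.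
Proof.
apply/continuousEP => q.
change (turning_fun (swap a) 0 q = turning_fun a 0 q); rewrite !turning_funE.
by case: a => /=; rewrite !subr0 maxC.
Qed.

Lemma turning_horo_eq a a' (m n : R) : 0 <= m -> 0 <= n ->
  turning_horo a m = turning_horo a' n <->
  (a = a' /\ m = n) \/ (a' = swap a /\ m = 0 /\ n = 0).
Proof.
move=> m0 n0; split=> [/continuousEP E|[[-> ->] //|[-> [-> ->]]]]; last first.
  by rewrite turning_horo_swap.
(* m + n + 1 exceeds both delays, as [turning_fun_axes] needs it to. *)
have /(turning_fun_axes a) : 0 <= m <= m + n + 1 by lra.
have {}E q : turning_fun a m q = turning_fun a' n q := E q.
rewrite !E turning_fun_axes => [{}E|]; last lra.
case: a E; case: a' => /= -[] *;
  first [by left; split; [reflexivity|lra]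
        |by right; split; [reflexivity|split; lra]|by exfalso; lra].
Qed.

(** * Horofunctions attached to the points of the circle *)

(** The coordinate in the direction [P] of the radial projection of [c] to the
    square of sup norm 1. *)
Definition gauge P (c : R * R) := - axial_fun P c / sup_norm c.

(** The function A_P(q) + 1 - 1/t, where t is the gauge of [c], with t cut off
    at 1/(1 + 2|q|).  Where the cutoff is reached, the term with and the one
    without it are both at most A_P(q) - 2|q| <= -|q|; the term of a direction
    with gauge 1, which always exists, is A_P(q) >= -|q|, so the maximum of
    the four terms does not see the cutoff.  Directions with nonpositive gauge are discarded for the same
    reason, and no case distinction spoils the continuity in [c]. *)
Definition compass_term P (c q : R * R) :=
  axial_fun P q + 1 - (Num.max (gauge P c) (1 + 2 * sup_norm q)^-1)^-1.

Definition compass (c q : R * R) :=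
  Num.max (Num.max (compass_term North c q) (compass_term East c q))
          (Num.max (compass_term South c q) (compass_term West c q)).

Lemma compass_le c q b : compass c q <= b <-> forall P, compass_term P c q <= b.
Proof.
rewrite /compass !ge_max; split=> [/andP[/andP[? ?] /andP[? ?]] []//|H].
by rewrite !H.
Qed.

Lemma compass_term_small P c q : gauge P c <= (1 + 2 * sup_norm q)^-1 ->
  compass_term P c q = axial_fun P q - 2 * sup_norm q.
Proof. by move=> g; rewrite /compass_term max_r // invrK; lra. Qed.

Lemma compass_term_large P c q : (1 + 2 * sup_norm q)^-1 <= gauge P c ->
  compass_term P c q = axial_fun P q - ((gauge P c)^-1 - 1).
Proof. by move=> g; rewrite /compass_term max_l //; lra. Qed.

Lemma invr_sup_norm_gt0 q : 0 < (1 + 2 * sup_norm q)^-1.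
Proof. by rewrite invr_gt0; have := sup_norm_ge0 q; lra. Qed.

Section compass_sector.
Variables (a : turn) (s r : R) (q : R * R).
Hypotheses (rs : 0 <= r <= s) (s0 : 0 < s).
Let c := sector a s r.

Let gauge_initial : gauge (initial a) c = 1.
Proof.
by rewrite /gauge axial_fun_initial_sector sup_norm_sector // opprK divff // gt_eqF.
Qed.

Let gauge_target : gauge (target a) c = r / s.
Proof. by rewrite /gauge axial_fun_target_sector sup_norm_sector // opprK. Qed.

Let gauge_opposite P : gauge (opposite P) c = - gauge P c.
Proof. by rewrite /gauge axial_fun_opposite opprK mulNr opprK. Qed.

Let term_initial : compass_term (initial a) c q = axial_fun (initial a) q.
Proof.
rewrite compass_term_large gauge_initial ?invr1 ?subrr ?subr0 //.
by rewrite invf_le1; have := sup_norm_ge0 q; lra.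
Qed.

Let term_small P : gauge P c <= (1 + 2 * sup_norm q)^-1 ->
  compass_term P c q <= axial_fun (initial a) q.
Proof.
move=> g; rewrite compass_term_small //.
have := axial_fun_le_norm P q; have := axial_fun_le_norm (opposite (initial a)) q.
by rewrite axial_fun_opposite; lra.
Qed.

Lemma compass_sector_axial : r = 0 -> compass c q = axial_fun (initial a) q.
Proof.
have d0 := invr_sup_norm_gt0 q.
move=> r0; apply/le_anti/andP; split; last first.
  by rewrite -term_initial; apply: (iffLR (compass_le _ _ _)).
apply/compass_le => P; case: (axis_of_turn a P) => ->; first by rewrite term_initial.
all: by apply: term_small; rewrite ?gauge_opposite ?gauge_initial ?gauge_target ?r0; lra.
Qed.

Lemma compass_sector_turning : 0 < r ->
  compass c q = turning_fun a (s / r - 1) q.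
Proof.
have d0 := invr_sup_norm_gt0 q.
move=> r0; have rs0 : 0 < r / s by rewrite divr_gt0.
have le_compass P : compass_term P c q <= compass c q by exact: (iffLR (compass_le _ _ _)).
rewrite turning_funE; apply/le_anti/andP; split.
  apply/compass_le => P; rewrite le_max.
  case: (lerP (gauge P c) (1 + 2 * sup_norm q)^-1) => [/term_small -> //|/ltW g].
  case: (axis_of_turn a P) g => -> g.
  - by rewrite term_initial lexx.
  - by move: g; rewrite gauge_opposite gauge_initial; lra.
  - by rewrite compass_term_large // gauge_target invf_div lexx orbT.
  - by move: g; rewrite gauge_opposite gauge_target; lra.
rewrite ge_max -{1}term_initial le_compass /=.
apply: le_trans (le_compass (target a)).
have : (Num.max (r / s) (1 + 2 * sup_norm q)^-1)^-1 <= s / r.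
  by rewrite -(invf_div r s) lef_pV2 ?posrE ?lt_max ?rs0 // le_max lexx.
by rewrite /compass_term gauge_target; lra.
Qed.

End compass_sector.

(** The cutoff keeps the gauges that are inverted away from 0. *)
Lemma continuous_compass q c : 0 < sup_norm c ->
  compass c' q @[c' --> c] --> compass c q.
Proof.
move=> c0.
have mx (f g : R * R -> R) : f x @[x --> c] --> f c -> g x @[x --> c] --> g c ->
    Num.max (f x) (g x) @[x --> c] --> Num.max (f c) (g c).
  by move=> cf cg; apply: (@continuous_max R _ f g).
have ct P : compass_term P c' q @[c' --> c] --> compass_term P c q.
  apply: cvgB; first exact: cvg_cst.
  apply: cvgV; first by rewrite gt_eqF // lt_max invr_sup_norm_gt0 orbT.
  apply: (mx); last exact: cvg_cst.
  apply: cvgM; first by apply: cvgN; exact: continuous_axial_fun.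
  apply: cvgV; first by rewrite gt_eqF.
  by apply: (mx); apply: cvg_norm; [exact: cvg_fst|exact: cvg_snd].
by apply: (mx); apply: (mx).
Qed.

(** * Angles *)

(** Signs of the coordinates and the comparison of their absolute values
    select the octant. *)
Lemma sector_cover (p : R * R) : exists a s r, p = sector a s r /\ 0 <= r <= s.
Proof.
case: p => x y; have sol a s r :
    (x, y) = sector a s r -> 0 <= r <= s ->
    exists a s r, (x, y) = sector a s r /\ 0 <= r <= s.
  by move=> *; exists a, s, r.
case: (lerP 0 x) => x0; case: (lerP 0 y) => y0; case: (lerP `|x| `|y|);
  rewrite ?(ger0_norm x0) ?(ltr0_norm x0) ?(ger0_norm y0) ?(ltr0_norm y0) => xy.
- by apply: (sol NE y x); rewrite ?sectorE ?opprK //; lra.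
- by apply: (sol EN x y); rewrite ?sectorE ?opprK //; lra.
- by apply: (sol SE (- y) x); rewrite ?sectorE ?opprK //; lra.
- by apply: (sol ES x (- y)); rewrite ?sectorE ?opprK //; lra.
- by apply: (sol NW y (- x)); rewrite ?sectorE ?opprK //; lra.
- by apply: (sol WN (- x) y); rewrite ?sectorE ?opprK //; lra.
- by apply: (sol SW (- y) (- x)); rewrite ?sectorE ?opprK //; lra.
- by apply: (sol WS (- x) (- y)); rewrite ?sectorE ?opprK //; lra.
Qed.

Lemma circle_sector a s r : circle R (sector a s r) -> s ^+ 2 + r ^+ 2 = 1.
Proof.
by rewrite sectorE /circle /=; case: a => /=; rewrite ?sqrrN // addrC.
Qed.

Lemma bearing_axis a : \val (bearing (axis_angle R (initial a))) = sector a 1 0.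
Proof.
have sw : 3 * pi / 2 = pi / 2 + pi :> R by lra.
rewrite sectorE /bearing; case: a => /=; rewrite ?sw ?sinDpi ?cosDpi;
  rewrite ?(sin0, cos0, sinpi, cospi, sin_pihalf, cos_pihalf); congr pair; lra.
Qed.

Lemma bearing_turn a (x : R) :
  \val (bearing (axis_angle R (initial a) + orientation R a * x)) =
  sector a (cos x) (sin x).
Proof.
have sw : 3 * pi / 2 = pi / 2 + pi :> R by lra.
rewrite sectorE /bearing /= sinD cosD; case: a => /=; rewrite ?sw ?sinDpi ?cosDpi
  ?(mul1r, mulN1r) ?(sinN, cosN) ?(sin0, cos0, sinpi, cospi, sin_pihalf, cos_pihalf);
  congr pair; lra.
Qed.

(** The point of the square of sup norm 1 attached to the delay [m] has second
    coordinate 1/(1 + m) in its octant; this is its angle from the axis. *)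
Definition delay_angle m : R := atan (1 + m)^-1.

Lemma delay_angle_inv01 m : 0 <= m -> 0 < (1 + m)^-1 <= 1.
Proof. by move=> m0; rewrite invr_gt0 invf_le1; lra. Qed.

Lemma delay_angle0 : delay_angle 0 = pi / 4.
Proof. by rewrite /delay_angle addr0 invr1 atan1. Qed.

Lemma delay_angle_decreasing m n : 0 <= m -> m < n -> delay_angle n < delay_angle m.
Proof. by move=> m0 mn; apply: lt_atan; rewrite ltf_pV2 ?posrE; lra. Qed.

Lemma delay_angle_cvg0 : delay_angle m @[m --> +oo%R] --> (0 : R).
Proof.
have inv0 : (fun m : R => (1 + m)^-1) @ +oo%R --> (0 : R).
  apply/(@gtr0_cvgV0 R R +oo%R _ (fun m => 1 + m)).
    near=> m; have : 0 < m by near: m; exact: nbhs_pinfty_gt (num_real _).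
    lra.
  apply/cvgryPge => A; near=> m.
  have : A <= m by near: m; exact: nbhs_pinfty_ge (num_real _).
  lra.
by have := cvg_comp _ _ inv0 (@continuous_atan R 0); rewrite atan0.
Unshelve. all: by end_near. Qed.

Lemma tan_itv01 (x : R) : 0 < x <= pi / 4 -> 0 < tan x <= 1.
Proof.
move=> /andP[x0 x4]; have pi0 := pi_gt0 R.
have xK : atan (tan x) = x by apply: tanK; rewrite in_itv /=; lra.
apply/andP; split; [rewrite ltNge|rewrite leNgt]; apply/negP => tx.
  by have := le_atan tx; rewrite xK atan0; lra.
by have := lt_atan tx; rewrite xK atan1; lra.
Qed.

Lemma delay_angle_image :
  delay_angle @` [set m | 0 <= m] = [set x | 0 < x <= pi / 4].
Proof.
apply/seteqP; split => [_ [m /= /delay_angle_inv01/andP[m0 m1] <-]|x /= x04].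
  by rewrite -(@atan0 R) -(@atan1 R) lt_atan ?le_atan.
have /andP[t0 t1] := tan_itv01 x04; exists ((tan x)^-1 - 1) => /=.
  by rewrite subr_ge0 invf_ge1.
rewrite /delay_angle addrC subrK invrK; apply: tanK; rewrite in_itv /=.
by have := pi_gt0 R; lra.
Qed.

(** The tangent of [delay_angle m] is 1/(1 + m). *)
Lemma sector_delay_angle a m : 0 <= m ->
  sector a (cos (delay_angle m)) (sin (delay_angle m)) =
  sector a (cos (delay_angle m)) (cos (delay_angle m) / (1 + m)) /\ 0 < cos (delay_angle m).
Proof.
move=> m0; have c0 : 0 < cos (delay_angle m).
  by rewrite cos_atan invr_gt0 sqrtr_gt0; have := sqr_ge0 (1 + m)^-1; lra.
split=> //; congr sector; have := atanK (1 + m)^-1; rewrite -/(delay_angle m) => <-.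
by rewrite /tan mulrCA divff ?mulr1 // gt_eqF.
Qed.

(** * The boundary is a circle *)

Lemma compass_bearing_axis P q :
  compass (\val (bearing (axis_angle R P))) q = axial_fun P q.
Proof.
have [a <-] := turn_from P.
by rewrite bearing_axis compass_sector_axial // ?lexx ?ler01 ?ltr01.
Qed.

Lemma compass_bearing_turn a m q : 0 <= m ->
  compass (\val (bearing (axis_angle R (initial a) + orientation R a * delay_angle m))) q
  = turning_fun a m q.
Proof.
move=> m0; rewrite bearing_turn; have [-> c0] := sector_delay_angle a m0.
have /andP[i0 i1] := delay_angle_inv01 m0.
rewrite compass_sector_turning ?mulr_gt0 //; last first.
  by rewrite ler_piMr ?(ltW c0) // andbT mulr_ge0 // ltW.
congr turning_fun; rewrite invf_div mulrCA divff ?gt_eqF // mulr1; lra.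
Qed.

(** On the circle s^2 + r^2 = 1, a point of an octant with r > 0 is reached with
    the delay m = s/r - 1. *)
Lemma circle_cover (c : circle R) :
  (exists P, c = bearing (axis_angle R P)) \/
  (exists a m, 0 <= m /\
     c = bearing (axis_angle R (initial a) + orientation R a * delay_angle m)).
Proof.
have cc := set_mem (valP c).
have [a [s [r [cE /andP[r0 rs]]]]] := sector_cover (\val c).
rewrite /= cE in cc; have {cc} sr1 := circle_sector cc.
have s0 : 0 < s by clear cE; nra.
case: (eqVneq r 0) => [rE|rN].
  left; exists (initial a); apply: val_inj; rewrite bearing_axis [LHS]cE rE.
  by congr sector; clear cE; rewrite rE in sr1; nra.
have {rN} r0 : 0 < r by rewrite lt_neqAle eq_sym rN.
have m0 : 0 <= s / r - 1 by rewrite subr_ge0 ler_pdivlMr // mul1r.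
right; exists a, (s / r - 1); split => //; apply: val_inj.
rewrite bearing_turn [LHS]cE; have [-> c0] := sector_delay_angle a m0.
(* s^2 + r^2 = 1 makes s the cosine of the angle whose tangent is r/s. *)
have cosE : cos (delay_angle (s / r - 1)) = s.
  rewrite cos_atan (addrC 1 (_ - 1)) subrK invf_div.
  have -> : 1 + (r / s) ^+ 2 = (s^-1) ^+ 2.
    by rewrite expr_div_n exprVn -[X in X + _](divff (_ : s ^+ 2 != 0)) ?expf_neq0 ?gt_eqF //
      -mulrDl sr1 mul1r.
  by rewrite sqrtr_sqr ger0_norm ?invr_ge0 ?ltW // invrK.
rewrite cosE (addrC 1 (_ - 1)) subrK invf_div mulrCA divff ?mulr1 //.
by rewrite gt_eqF.
Qed.

Lemma sup_norm_circle_gt0 (c : circle R) : 0 < sup_norm (\val c).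
Proof.
have := set_mem (valP c); rewrite /circle /= => cE.
rewrite lt_neqAle sup_norm_ge0 andbT; apply/eqP => c0.
have : sup_norm (\val c) <= 0 by rewrite -c0.
rewrite /sup_norm ge_max !normr_le0 => /andP[/eqP x0 /eqP y0].
by move: cE; rewrite x0 y0 expr0n /= addr0 => /esym/eqP; rewrite oner_eq0.
Qed.

Lemma compass_in_horoboundary (c : circle R) :
  exists h : horoboundary ((0, 0) : R * R), \val h =1 compass (\val c).
Proof.
have sol (h : Cspace (R * R)%type) f : horoboundary ((0, 0) : R * R) h ->
    h =1 f -> exists h : horoboundary ((0, 0) : R * R), \val h =1 f.
  by move=> hb hE; exists (exist _ h (mem_set hb)).
have [[P ->]|[a [m [m0 ->]]]] := circle_cover c.
- apply: (sol (axial_horo R P)).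
    by rewrite horoboundary_plane; left; exists P.
  by move=> q; rewrite compass_bearing_axis.
- apply: (sol (turning_horo a m)).
    by rewrite horoboundary_plane; right; exists a, m.
  by move=> q; rewrite compass_bearing_turn.
Qed.

(** Injectivity follows from the distinctness of the horofunctions: the only
    coincidences are those of the delay 0, where the two octants share their
    diagonal point. *)
Lemma circle_homeomorphism_horoboundary :
  exists Phi : circle R -> horoboundary ((0, 0) : R * R),
    homeomorphism Phi /\ forall c, \val (Phi c) =1 compass (\val c).
Proof.
have [Phi PhiE] := choice compass_in_horoboundary; exists Phi; split => //.
have PhiP P : \val (Phi (bearing (axis_angle R P))) = axial_horo R P.
  by apply/continuousEP => q; rewrite PhiE compass_bearing_axis.
have PhiT a m : 0 <= m -> \val (Phi (bearing (axis_angle R (initial a) +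
    orientation R a * delay_angle m))) = turning_horo a m.
  by move=> m0; apply/continuousEP => q; rewrite PhiE compass_bearing_turn.
apply: compact_hausdorff_homeomorphism.
- exact/compact_set_type/compact_circle.
- exact/hausdorff_set_type/hausdorff_Cspace.
- move=> c; suff vc : (fun c' => set_val (Phi c')) @ nbhs c --> set_val (Phi c).
    have FF : Filter (Phi @ nbhs c) by exact: fmap_filter.
    exact: (@cvg_initial _ _ set_val (Phi @ nbhs c) (Phi c) FF vc).
  apply: (@cvg_Cspace_pointwise R (R * R)%type (circle R) (nbhs c)
    (fun c' => set_val (Phi c')) _ _) => [c'|q].
    by have [+ _] := set_valP (Phi c'); exact: lipschitz1_closure.
  rewrite PhiE; under eq_fun do rewrite PhiE.
  have cc := @continuous_compass q _ (sup_norm_circle_gt0 c).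
  exact: (cvg_comp _ _ (@initial_continuous (circle R) _ set_val c) cc).
- have inj : injective Phi.
    move=> c c' /(congr1 val).
    have [[P ->]|[a [m [m0 ->]]]] := circle_cover c;
      have [[Q ->]|[a' [n [n0 ->]]]] := circle_cover c'; rewrite ?PhiP ?PhiT //.
    + by move/axial_horo_inj => ->.
    + by move/(axial_horo_neq_turning n0).
    + by move/esym/(axial_horo_neq_turning m0).
    + move/(turning_horo_eq _ _ m0 n0) => [[-> ->]//|[-> [-> ->]]].
      apply: val_inj; rewrite !bearing_turn.
      have [-> _] := sector_delay_angle a (lexx 0).
      have [-> _] := sector_delay_angle (swap a) (lexx 0).
      by rewrite addr0 divr1 !sectorE; case: (a).
  have /choice[g gK] : forall h, exists c, Phi c = h.
    move=> h; have [[P _ hE]|[a [m [m0 hE]]]] : (range (axial_horo R) `|`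
        [set k | exists a m, 0 <= m /\ k = turning_horo a m]) (\val h).
    - by rewrite -horoboundary_plane; exact: set_valP.
    - by exists (bearing (axis_angle R P)); apply: val_inj; rewrite PhiP.
    - exists (bearing (axis_angle R (initial a) + orientation R a * delay_angle m)).
      by apply: val_inj; rewrite PhiT.
  by exists g => // c; apply: inj; rewrite gK.
Qed.

End sup_plane.

Theorem theoremD (R : realType) :
  let origin : R * R := (0, 0) in
  let bdry := horoboundary origin in
  (* the axial and turning paths are geodesic rays from the origin *)
  (forall P : axis,
     axial_ray R P 0 = origin /\ geodesic_ray (axial_ray R P)) /\
  (forall (a : turn) (m : R), 0 <= m ->
     turning_ray R a m 0 = origin /\ geodesic_ray (turning_ray R a m)) /\
  (* their limits in C(X) *)
  (forall P : axis,
     Psi origin (axial_ray R P t) @[t --> +oo%R] --> axial_horo R P) /\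
  (forall (a : turn) (m : R), 0 <= m ->
     Psi origin (turning_ray R a m t) @[t --> +oo%R] --> turning_horo a m) /\
  (* the boundary consists exactly of these limits *)
  bdry = range (axial_horo R) `|`
         [set h | exists (a : turn) (m : R), 0 <= m /\ h = turning_horo a m] /\
  (* all distinct except at the diagonal points *)
  (forall P Q : axis, axial_horo R P = axial_horo R Q -> P = Q) /\
  (forall (P : axis) (a : turn) (m : R), 0 <= m ->
     axial_horo R P <> turning_horo a m) /\
  (forall (a b : turn) (m n : R), 0 <= m -> 0 <= n ->
     turning_horo a m = turning_horo b n <->
     (a = b /\ m = n) \/ (b = swap a /\ m = 0 /\ n = 0)) /\
  (* the boundary is a circle, with the points arranged in order *)
  exists Phi : circle R -> bdry,
    homeomorphism Phi /\
    (forall P : axis, \val (Phi (bearing (axis_angle R P))) = axial_horo R P) /\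
    exists phi : turn -> R -> R,
      forall a : turn,
        [/\ phi a 0 = pi / 4,
            (forall m n : R, 0 <= m -> m < n -> phi a n < phi a m),
            phi a m @[m --> +oo%R] --> (0 : R),
            phi a @` [set m | 0 <= m] = [set s | 0 < s <= pi / 4] &
            forall m : R, 0 <= m ->
              \val (Phi (bearing (axis_angle R (initial a)
                                  + orientation R a * phi a m)))
              = turning_horo a m].
Proof.
move=> origin bdry; split; first exact: geodesic_axial_ray.
split; first exact: geodesic_turning_ray.
split; first exact: cvg_axial_ray.
split; first exact: cvg_turning_ray.
split; first exact: horoboundary_plane.
split; first exact: axial_horo_inj.
split; first exact: axial_horo_neq_turning.
split; first exact: turning_horo_eq.
have [Phi [homPhi PhiE]] := circle_homeomorphism_horoboundary R.
exists Phi; split => //; split.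
  by move=> P; apply/continuousEP => q; rewrite PhiE compass_bearing_axis.
exists (fun=> @delay_angle R) => a; split.
- exact: delay_angle0.
- exact: delay_angle_decreasing.
- exact: delay_angle_cvg0.
- exact: delay_angle_image.
- by move=> m m0; apply/continuousEP => q; rewrite PhiE compass_bearing_turn.
Qed.
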